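(* Let $\epsilon > 0$ and $d > 0$, and let $G$ be a graph on $n$ vertices satisfying the following three conditions: (i) $G$ is $\frac{\epsilon}{2}$-locally sparse, i.e. for every subset $U \subseteq V(G)$ with $|U| \le \frac{\epsilon}{2} n$, the average degree of the induced subgraph $G[U]$ is at most $\frac{\epsilon}{2} d$; (ii) $G$ is $\epsilon$-vertex-expanding, i.e. for every subset $U \subseteq V(G)$ with $|U| \le \frac{n}{2}$ we have $|N(U)| \ge \epsilon |U|$; (iii) $G$ has minimum degree $d$. Then $G$ contains a clique minor (a complete graph minor) of size $$\tilde{\Omega}\left(\frac{\sqrt{nd}}{\log^{10} n}\right).$$
   Context: All graphs are finite, simple and undirected. A graph $H$ is a minor of $G$ if $H$ can be obtained from $G$ by vertex deletions, edge deletions and edge contractions; a clique minor of size $k$ is a minor isomorphic to the complete graph $K_k$. For $U \subseteq V(G)$, $N(U)$ denotes the set of vertices outside $U$ that have a neighbour in $U$ (external neighbourhood). The average degree of a graph $H$ is $2e(H)/|V(H)|$. The notation $\tilde{\Omega}(f(n))$ means a quantity bounded below by $f(n)$ divided by a polylogarithmic factor in $n$, up to a positive multiplicative constant (which may depend on $\epsilon$), for $n$ sufficiently large. *)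

(* Defs.v *)
From HB Require Import structures.
From mathcomp Require Import all_boot all_order all_algebra.
From mathcomp Require Import reals.
Set Implicit Arguments.
Unset Strict Implicit.
Unset Printing Implicit Defensive.
Import Order.TTheory GRing.Theory Num.Theory.
Local Open Scope ring_scope.

Record sgraph := SGraph {
  vertex :> finType;
  adj : rel vertex;
  adj_sym : symmetric adj;
  adj_irrefl : irreflexive adj }.

Section Operations.
Variable G : sgraph.

Section Induced.
Variable U : {set G}.

Definition induced_rel : rel {x : G | x \in U} :=
  [rel u v | adj (val u) (val v)].

Lemma induced_sym : symmetric induced_rel.
Proof. by move=> u v; rewrite /induced_rel /= adj_sym. Qed.

Lemma induced_irrefl : irreflexive induced_rel.
Proof. by move=> u; rewrite /induced_rel /= adj_irrefl. Qed.

Definition induced : sgraph := SGraph induced_sym induced_irrefl.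
End Induced.

Definition del_vertex (v : G) : sgraph := induced [set~ v].

Section Edge.
Variables x y : G.

Definition del_edge_rel : rel G :=
  [rel u v | adj u v && ([set u; v] != [set x; y])].

Lemma del_edge_sym : symmetric del_edge_rel.
Proof. by move=> u v; rewrite /del_edge_rel /= adj_sym [[set v; u]]setUC. Qed.

Lemma del_edge_irrefl : irreflexive del_edge_rel.
Proof. by move=> u; rewrite /del_edge_rel /= adj_irrefl. Qed.

Definition del_edge : sgraph := SGraph del_edge_sym del_edge_irrefl.

(* The edge xy is contracted onto x: the vertex y disappears and x inherits
   its neighbours; loops and parallel edges are discarded. *)
Definition contract_rel : rel {z : G | z \in [set~ y]} :=
  [rel u v | (u != v) &&
     [|| adj (val u) (val v),
         (val u == x) && adj y (val v) |
         (val v == x) && adj y (val u)]].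

Lemma contract_sym : symmetric contract_rel.
Proof.
move=> u v; rewrite /contract_rel /= eq_sym adj_sym.
by congr (_ && (_ || _)); exact: orbC.
Qed.

Lemma contract_irrefl : irreflexive contract_rel.
Proof. by move=> u; rewrite /contract_rel /= eqxx. Qed.

Definition contract : sgraph := SGraph contract_sym contract_irrefl.
End Edge.
End Operations.

Inductive minor (G : sgraph) : sgraph -> Prop :=
| minor_refl : minor G G
| minor_del_vertex (H : sgraph) (v : H) :
    minor G H -> minor G (del_vertex v)
| minor_del_edge (H : sgraph) (x y : H) :
    minor G H -> adj x y -> minor G (del_edge x y)
| minor_contract (H : sgraph) (x y : H) :
    minor G H -> adj x y -> minor G (contract x y).

Definition isomorphic (G H : sgraph) : Prop :=
  exists f : G -> H, bijective f /\ forall x y, adj (f x) (f y) = adj x y.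

Definition complete_rel (k : nat) : rel 'I_k := [rel i j | i != j].

Lemma complete_sym k : symmetric (@complete_rel k).
Proof. by move=> i j; rewrite /complete_rel /= eq_sym. Qed.

Lemma complete_irrefl k : irreflexive (@complete_rel k).
Proof. by move=> i; rewrite /complete_rel /= eqxx. Qed.

Definition complete_graph (k : nat) : sgraph :=
  SGraph (@complete_sym k) (@complete_irrefl k).

Definition has_clique_minor (G : sgraph) (k : nat) : Prop :=
  exists H : sgraph, minor G H /\ isomorphic H (complete_graph k).

Definition edges (G : sgraph) : {set {set G}} :=
  [set e : {set G} | [exists x, exists y, adj x y && (e == [set x; y])]].

Definition degree (G : sgraph) (x : G) : nat := #|[set y | adj x y]|.

Definition has_min_degree (G : sgraph) (d : nat) : Prop :=
  (forall x : G, (d <= degree x)%N) /\ (exists x : G, degree x = d).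

Definition ext_neighbourhood (G : sgraph) (U : {set G}) : {set G} :=
  [set v | (v \notin U) && [exists u in U, adj u v]].

(* On the graph without vertices this is 0, since division by 0 yields 0. *)
Definition average_degree (R : realType) (G : sgraph) : R :=
  2 * #|edges G|%:R / #|G|%:R.

Definition locally_sparse (R : realType) (alpha d : R) (G : sgraph) : Prop :=
  forall U : {set G}, #|U|%:R <= alpha * #|G|%:R ->
    average_degree R (induced U) <= alpha * d.

Definition vertex_expanding (R : realType) (eps : R) (G : sgraph) : Prop :=
  forall U : {set G}, #|U|%:R <= #|G|%:R / 2 :> R ->
    eps * #|U|%:R <= #|ext_neighbourhood U|%:R.

(* Main.v *)
(* Branch sets are grown one after the other inside the part of [G] that is left
   over by the earlier branch sets [M] and by a maximal "junk" set with few
   neighbours outside [M].  The junk is small because [G] expands, and what is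
   left over expands by maximality, so that any set of its vertices can be
   connected at logarithmic cost per vertex.

   If [d] is polylogarithmic, this is the argument of Plotkin, Rao and Smith: a
   new branch set picks a neighbour of every earlier one, and a branch set all
   of whose outside neighbours are used up is thrown into the junk.  It yields a
   clique minor of size about sqrt n.

   If [d] is larger, a branch set contains about sqrt (n / d) star centres with
   about sqrt (n d) leaves in total, which exist because, by local sparsity, all
   but few vertices keep d / 4 neighbours outside any given small set.  A greedy
   hitting set of about sqrt (n / d) vertices then meets the leaf sets of all
   earlier branch sets that still have half of their leaves available.  Since no
   vertex is a leaf of more than d / polylog n branch sets, [M] and the junk use
   up few leaf sets, so at the end half of the branch sets are still alive, and
   these are pairwise adjacent. *)
Require Import Defs.
From mathcomp Require Import all_boot all_order all_algebra.
From mathcomp Require Import reals exp zify ring.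
Set Implicit Arguments.
Unset Strict Implicit.
Unset Printing Implicit Defensive.
Import Order.TTheory GRing.Theory Num.Theory.
Local Open Scope nat_scope.

(** * Clique minors from branch sets *)

(** Connectivity by cuts instead of paths. The empty set passes, so nonemptiness of branch sets is
    required separately. *)
Definition connected_set (G : sgraph) (A : {set G}) :=
  forall (S : {set G}) (x y : G),
    x \in A -> x \in S -> y \in A -> y \notin S ->
    exists u v, [/\ u \in A, u \in S, v \in A, v \notin S & adj u v].

Definition adjacent_sets (G : sgraph) (A B : {set G}) :=
  exists u v, [/\ u \in A, v \in B & adj u v].

Definition clique_model (H : sgraph) (t : nat) (phi : H -> option 'I_t) :=
  [/\ forall i, exists x, phi x = Some i,
      forall i, connected_set [set x | phi x == Some i] &
      forall i j, i != j ->
        exists x y, [/\ phi x = Some i, phi y = Some j & adj x y]].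

Lemma clique_model_del_vertex (H : sgraph) t (phi : H -> option 'I_t) (v : H) :
  clique_model phi -> phi v = None ->
  clique_model (fun u : del_vertex v => phi (val u)).
Proof.
move=> [ne co ad] pv.
have lift x i : phi x = Some i -> x \in [set~ v].
  by move=> px; rewrite !inE; apply/eqP => xv; rewrite xv pv in px.
split.
- by move=> i; have [x px] := ne i; exists (exist _ x (lift _ _ px)).
- move=> i S x y; rewrite !inE => px xS py yS.
  have [||||u [w [+ uS + wS uw]]] :=
    co i [set z | [exists z' in S, val z' == z]] (val x) (val y);
    rewrite ?inE //.
  + by apply/existsP; exists x; rewrite xS eqxx.
  + apply/existsP => -[z /andP[zS /eqP/val_inj zy]].
    by rewrite -zy zS in yS.
  + move=> /eqP pu /eqP pw.
    exists (exist _ u (lift _ _ pu)), (exist _ w (lift _ _ pw)).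
    split; rewrite ?inE /= ?pu ?pw //.
    * move: uS; rewrite inE => /existsP[z /andP[zS /eqP zu]].
      by rewrite (_ : exist _ _ _ = z) //; apply: val_inj.
    * apply: contra wS => wS; rewrite inE; apply/existsP.
      by exists (exist _ w (lift _ _ pw)); rewrite wS /=.
- move=> i j /ad[x [y [px py xy]]].
  by exists (exist _ x (lift _ _ px)), (exist _ y (lift _ _ py)).
Qed.

Lemma clique_model_contract (H : sgraph) t (phi : H -> option 'I_t) (x y : H) :
  clique_model phi -> adj x y -> phi x = phi y ->
  clique_model (fun u : contract x y => phi (val u)).
Proof.
move=> [ne co ad] xy pxy.
have xny : x \in [set~ y].
  by rewrite !inE; apply/eqP => e; rewrite e adj_irrefl in xy.
(* [p] is the quotient map: it fixes every vertex except [y], which falls to the default [x]. *)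
pose p (z : H) : contract x y := insubd (exist _ x xny) z.
have py : p y = exist _ x xny.
  rewrite /p /insubd insubN //; change (y \notin [set~ y]).
  by rewrite !inE negbK.
have pK (z : contract x y) : p (val z) = z by exact: valKd.
have vp z : z != y -> val (p z) = z by move=> zy; rewrite val_insubd !inE zy.
have phip z : phi (val (p z)) = phi z.
  by have [->|zy] := eqVneq z y; [rewrite py | rewrite vp].
have adjp u v : adj u v -> p u != p v -> adj (p u) (p v).
  move=> uv puv; apply/andP; split=> //.
  have [ey|uy] := eqVneq u y; have [ev|vy] := eqVneq v y.
  - by rewrite ey ev adj_irrefl in uv.
  - by subst u; rewrite py /= vp // eqxx uv orbT.
  - by subst v; rewrite py /= vp // eqxx (adj_sym y u) uv !orbT.
  - by rewrite !vp // uv.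
split.
- by move=> i; have [z pz] := ne i; exists (p z); rewrite phip.
- move=> i S z1 z2; rewrite !inE => pz1 z1S pz2 z2S.
  have [||||u [w [+ uS + wS uw]]] :=
    co i [set z | p z \in S] (val z1) (val z2); rewrite ?inE ?pK //.
  move=> /eqP pu /eqP pw; rewrite !inE in uS wS.
  exists (p u), (p w); rewrite !inE !phip pu pw; split=> //.
  by apply: adjp => //; apply: contraNneq wS => <-.
- move=> i j ij; have [u [v [pu pv uv]]] := ad _ _ ij.
  exists (p u), (p v); rewrite !phip; split=> //; apply: adjp => //.
  apply: contraNneq ij => e; move: (phip u); rewrite e phip pv pu.
  by case=> ->.
Qed.

(** Induction on the number of vertices: delete an unlabelled vertex, or else contract an edge
    inside a branch set. When neither exists, every vertex is labelled and every branch set is a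
    single vertex, so [H] itself is complete. *)
Lemma clique_model_minor (G : sgraph) (t : nat) (H : sgraph)
    (phi : H -> option 'I_t) :
  minor G H -> clique_model phi -> has_clique_minor G t.
Proof.
have [m] := ubnP #|H|; elim: m H phi => // m IH H phi Hm GH mo.
case: (pickP (fun v => phi v == None)) => [v /eqP pv|noN].
  apply: IH (minor_del_vertex v GH) (clique_model_del_vertex mo pv).
  rewrite /= card_sig cardsC1; move: Hm; have := max_card (pred1 v).
  by rewrite card1; case: #|H|.
case: (pickP (fun z : H * H => adj z.1 z.2 && (phi z.1 == phi z.2)))
    => [[x y] /= /andP[xy /eqP pxy]|noE].
  apply: IH (minor_contract GH xy) (clique_model_contract mo xy pxy).
  rewrite /= card_sig cardsC1; move: Hm; have := max_card (pred1 x).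
  by rewrite card1; case: #|H|.
have [ne co ad] := mo.
have inj x y : phi x = phi y -> x = y.
  move=> e; apply/eqP; apply/negPn/negP => nxy.
  case px: (phi x) => [i|]; last by move: (noN x); rewrite px eqxx.
  have [||||u [v [+ _ + _ uv]]] :=
    co i [set x] x y; rewrite ?inE -?e ?px ?eqxx // ?(eq_sym y) //.
  move=> /eqP pu /eqP pv; move: (noE (u, v)); rewrite /= uv pu pv.
  by rewrite eqxx.
have tot x : exists i : complete_graph t, phi x == Some i.
  by case px: (phi x) => [i|]; [exists i | move: (noN x); rewrite px eqxx].
pose f x := xchoose (tot x).
have fP x : phi x = Some (f x) by apply/eqP; exact: xchooseP (tot x).
exists H; split=> //; exists f; split.
  apply: inj_card_bij => [x y e|]; first by apply: inj; rewrite !fP e.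
  have {}ne i : exists x, phi x == Some i.
    by have [x px] := ne i; exists x; rewrite px.
  rewrite -(card_imset predT (_ : injective (fun i => xchoose (ne i)))).
    exact: max_card.
  move=> i j e; have /eqP := xchooseP (ne i); rewrite e.
  by rewrite (eqP (xchooseP (ne j))) => -[].
move=> x y; have [<-|nxy] := eqVneq x y; first by rewrite !adj_irrefl.
have fxy : f x != f y.
  by apply: contraNneq nxy => e; apply/eqP/inj; rewrite !fP e.
have [u [v [pu pv uv]]] := ad _ _ fxy.
have ux : u = x by apply: inj; rewrite pu fP.
have vy : v = y by apply: inj; rewrite pv fP.
by rewrite ux vy in uv; rewrite uv; exact: fxy.
Qed.

Lemma clique_minor_of_sets (G : sgraph) (F : {set {set G}}) :
  trivIset F ->
  (forall A, A \in F -> A != set0 /\ connected_set A) ->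
  (forall A B, A \in F -> B \in F -> A != B -> adjacent_sets A B) ->
  has_clique_minor G #|F|.
Proof.
move=> tF F1 F2.
pose ev (i : 'I_#|F|) : {set G} := enum_val i.
have ev_inj : injective ev by exact: enum_val_inj.
have memb (i : 'I_#|F|) : ev i \in F by exact: enum_valP.
pose phi (x : G) : option 'I_#|F| := [pick i | x \in ev i].
have phiP x (i : 'I_#|F|) : (phi x == Some i) = (x \in ev i).
  rewrite /phi; case: pickP => [j xj|/(_ i) -> //].
  apply/eqP/idP => [[<-] //|xi]; congr Some; apply: ev_inj.
  apply/eqP; apply/negPn/negP => /(trivIsetP tF _ _ (memb j) (memb i)).
  by move/pred0P/(_ x); rewrite /= xj xi.
apply: (clique_model_minor (phi := phi) (minor_refl G)); split.
- move=> i; have [/set0Pn[x xi] _] := F1 _ (memb i).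
  by exists x; apply/eqP; rewrite phiP.
- move=> i; have [_] := F1 _ (memb i); congr connected_set.
  by apply/setP => x; rewrite inE phiP.
- move=> i j ij; have [|u [v [ui vj uv]]] := F2 _ _ (memb i) (memb j).
    by rewrite (inj_eq ev_inj).
  by exists u, v; split=> //; apply/eqP; rewrite phiP.
Qed.

(** * Connecting vertices in expanders *)

Lemma connected_set1 (G : sgraph) (x : G) : connected_set [set x].
Proof. by move=> S u v; rewrite !inE => /eqP-> xS /eqP->; rewrite xS. Qed.

Lemma connected_setU_adj (G : sgraph) (A B : {set G}) :
  connected_set A -> connected_set B -> adjacent_sets A B ->
  connected_set (A :|: B).
Proof.
move=> cA cB [a [b [aA bB ab]]] S x y xU xS yU yS.
have widen (C : {set G}) : C \subset A :|: B ->
    (exists u v, [/\ u \in C, u \in S, v \in C, v \notin S & adj u v]) ->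
    exists u v,
      [/\ u \in A :|: B, u \in S, v \in A :|: B, v \notin S & adj u v].
  move=> sC [u [v [uC uS vC vS uv]]].
  by exists u, v; split=> //; exact: (subsetP sC).
have [sA sB] := (subsetUl A B, subsetUr A B).
have [aS|aS] := boolP (a \in S); have [bS|bS] := boolP (b \in S).
- case/setUP: yU => yU; [apply: (widen A)|apply: (widen B)] => //.
    exact: (cA S a y).
  exact: (cB S b y).
- by exists a, b; rewrite !inE aA bB orbT.
- by exists b, a; rewrite !inE aA bB orbT adj_sym.
- case/setUP: xU => xU; [apply: (widen A)|apply: (widen B)] => //.
    exact: (cA S x a).
  exact: (cB S x b).
Qed.

Lemma connected_bigcup (G : sgraph) (I : finType) (X : {set I})
    (P : I -> {set G}) (x0 : G) :
  (forall i, i \in X -> connected_set (P i) /\ x0 \in P i) ->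
  connected_set (\bigcup_(i in X) P i).
Proof.
move=> HP S x y /bigcupP[i iX xi] xS /bigcupP[j jX yj] yS.
have [ci x0i] := HP _ iX; have [cj x0j] := HP _ jX.
have [x0S|x0S] := boolP (x0 \in S).
  have [u [v [uC uS vC vS uv]]] := cj S x0 y x0j x0S yj yS.
  by exists u, v; split=> //; apply/bigcupP; exists j.
have [u [v [uC uS vC vS uv]]] := ci S x x0 xi xS x0i x0S.
by exists u, v; split=> //; apply/bigcupP; exists i.
Qed.

Lemma exists_subset_card (T : finType) (A : {set T}) (m : nat) :
  m <= #|A| -> exists2 B : {set T}, B \subset A & #|B| = m.
Proof.
case/card_geqP=> s [us <- sA]; exists [set x in s].
  by apply/subsetP => x; rewrite inE; exact: sA.
by rewrite cardsE; exact/card_uniqP.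
Qed.

Lemma card_bigcup_le (T I : finType) (X : {set I}) (P : I -> {set T}) :
  #|\bigcup_(i in X) P i| <= \sum_(i in X) #|P i|.
Proof.
apply: (big_ind2 (fun (A : {set T}) m => #|A| <= m)) => //.
- by rewrite cards0.
- move=> A m B k Am Bk.
  by rewrite (leq_trans (leq_card_setU _ _)) // leq_add.
Qed.

(** Bernoulli's inequality. It makes balls double in size and hitting sets halve a family. *)
Lemma expn_addl_double (m p k : nat) :
  0 < k -> m <= k * p -> 2 * m ^ k <= (m + p) ^ k.
Proof.
have bern j : m ^ j.+1 + j.+1 * p * m ^ j <= (m + p) ^ j.+1.
  elim: j => [|j IH]; first by rewrite !expn1 expn0; lia.
  rewrite [(m + p) ^ _]expnS; apply: leq_trans (leq_mul (leqnn _) IH).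
  by rewrite !(expnS m); nia.
case: k => // k _ mkp; apply: leq_trans (bern k).
by rewrite expnS; nia.
Qed.

Section Expanding.
Variables (G : sgraph) (q : nat).
Hypothesis q_gt0 : 0 < q.

Section Balls.
Variable V : {set G}.

Fixpoint ball (r : nat) (x : G) : {set G} :=
  if r is r'.+1 then ball r' x :|: (ext_neighbourhood (ball r' x) :&: V)
  else [set x].

Lemma ball_sub r x : x \in V -> ball r x \subset V.
Proof.
move=> xV; elim: r => [|r IH] /=; first by rewrite sub1set.
by rewrite subUset IH subsetIr.
Qed.

Lemma ball_center r x : x \in ball r x.
Proof. by elim: r => [|r IH] /=; rewrite inE ?IH. Qed.

Lemma ball_connect r x y : x \in V -> y \in ball r x ->
  exists P : {set G},
    [/\ P \subset V, connected_set P, x \in P, y \in P & #|P| <= r.+1].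
Proof.
move=> xV; elim: r y => [|r IH] y /=.
  rewrite inE => /eqP->; exists [set x]; rewrite sub1set xV inE eqxx cards1.
  by split=> //; exact: connected_set1.
case/setUP => [/IH[P [PV cP xP yP Pr]]|].
  by exists P; split=> //; exact: leqW.
rewrite !inE => /andP[/andP[_ /existsP[z /andP[zB zy]] yV]].
have [P [PV cP xP zP Pr]] := IH z zB.
exists (P :|: [set y]); split.
- by rewrite subUset PV sub1set.
- apply: connected_setU_adj => //; first exact: connected_set1.
  by exists z, y; rewrite !inE.
- by rewrite inE xP.
- by rewrite !inE eqxx orbT.
- by apply: leq_trans (leq_card_setU _ _) _; rewrite cards1 addn1 ltnS.
Qed.

Hypothesis V_expands : forall U : {set G}, U \subset V -> U != set0 ->
  2 * #|U| <= #|G| -> #|U| <= 2 * q * #|ext_neighbourhood U :&: V|.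

Lemma ball_growth r x : x \in V ->
  (#|G| < 2 * #|ball r x|) ||
  ((2 * q).+1 ^ r <= #|ball r x| * (2 * q) ^ r).
Proof.
move=> xV; elim: r => [|r IH] /=; first by rewrite cards1 orbT.
have dis : [disjoint ball r x & ext_neighbourhood (ball r x) :&: V].
  by rewrite disjoint_subset; apply/subsetP => y yB; rewrite !inE yB.
rewrite cardsU (disjoint_setI0 dis) cards0 subn0.
have [big|small] := ltnP #|G| (2 * #|ball r x|).
  by apply/orP; left; rewrite mulnDr ltn_addr.
case/orP: IH => [|IH]; first by rewrite ltnNge small.
apply/orP; right.
have B0 : ball r x != set0 by apply/set0Pn; exists x; exact: ball_center.
have := V_expands (ball_sub r xV) B0 small.
set s := #|ball r x| in IH *; set e := #|_ :&: _|; rewrite !expnS => H.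
apply: leq_trans (leq_mul (leqnn _) IH) _; rewrite !mulnA leq_mul2r.
by apply/orP; right; nia.
Qed.

Lemma ball_large l x : #|G| < 2 ^ l -> x \in V ->
  #|G| < 2 * #|ball (2 * q * l) x|.
Proof.
move=> Gl xV; case/orP: (ball_growth (2 * q * l) xV) => // H.
have l_gt0 : 0 < l.
  by case: l Gl {H} => //; rewrite expn0 ltnS leqn0 => /eqP/card0_eq/(_ x).
(* Below half of [G] a step multiplies the ball by at least 1 + 1/(2q), so [2 * q] steps double it
   and [2 * q * l] steps give a factor [2 ^ l > #|G|]. *)
have step : 2 ^ l * (2 * q) ^ (2 * q * l) <= (2 * q).+1 ^ (2 * q * l).
  set k := 2 * q; rewrite !(expnM _ k l) -expnMn leq_exp2r // -(addn1 k).
  by apply: expn_addl_double; rewrite ?muln1 // muln_gt0.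
have := leq_trans step H; rewrite leq_mul2r expn_eq0 muln_eq0 /=.
case: eqP => [|_ /=]; first lia.
by have := max_card (ball (2 * q * l) x); lia.
Qed.

(** Two balls of radius [2 * q * l] each fill more than half of [G] and so meet. Each vertex of [X]
    is linked in this way to a fixed [x0] by at most [2 * (2 * q * l + 1)] vertices. *)
Lemma connect_in_expander l (X : {set G}) :
  #|G| < 2 ^ l -> X \subset V -> X != set0 ->
  exists Y : {set G}, [/\ X \subset Y, Y \subset V, connected_set Y &
    #|Y| <= #|X| * (4 * q * l + 2)].
Proof.
move=> Gl /subsetP XV /set0Pn[x0 x0X].
have join x : exists P : {set G}, x \in X -> [&& P \subset V, x0 \in P,
    x \in P & #|P| <= 4 * q * l + 2] /\ connected_set P.
  have [xX|] := boolP (x \in X); last by exists set0.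
  have [xV x0V] := (XV _ xX, XV _ x0X).
  have [z zx z0] : exists2 z, z \in ball (2 * q * l) x
                            & z \in ball (2 * q * l) x0.
    have: ball (2 * q * l) x :&: ball (2 * q * l) x0 != set0.
      rewrite -card_gt0; have := ball_large Gl xV; have := ball_large Gl x0V.
      have := cardsUI (ball (2 * q * l) x) (ball (2 * q * l) x0).
      have := max_card (ball (2 * q * l) x :|: ball (2 * q * l) x0).
      set a := #|_ :|: _|; set b := #|_ :&: _|; lia.
    by case/set0Pn => z /setIP[zx z0]; exists z.
  have [P [PV cP xP zP Pr]] := ball_connect xV zx.
  have [Q [QV cQ x0Q zQ Qr]] := ball_connect x0V z0.
  exists (\bigcup_(A in [set P; Q]) A) => _; split; last first.
    by apply: (connected_bigcup (x0 := z)) => A /set2P[]->.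
  rewrite bigcup_setU !big_set1 subUset PV QV !inE x0Q xP orbT /=.
  by rewrite (leq_trans (leq_card_setU _ _)) //; lia.
have [P HP] := fin_all_exists join.
exists (\bigcup_(x in X) P x); split.
- apply/subsetP => x xX; apply/bigcupP; exists x => //.
  by have [/and4P[]] := HP x xX.
- by apply/bigcupsP => x xX; have [/and4P[]] := HP x xX.
- by apply: (connected_bigcup (x0 := x0)) => x xX; have [/and4P[]] := HP x xX.
- rewrite (leq_trans (card_bigcup_le _ _)) // -sum_nat_const.
  by apply: leq_sum => x xX; have [/and4P[]] := HP x xX.
Qed.
End Balls.

(** The quarter leaves room: a junk set together with another set of at most a quarter of the
    vertices stays within the half for which [G] expands. *)
Definition junk (M R : {set G}) :=
  [&& [disjoint R & M], 4 * #|R| <= #|G| &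
      2 * q * #|ext_neighbourhood R :\: M| <= #|R|].

Hypothesis G_expands : forall U : {set G},
  2 * #|U| <= #|G| -> #|U| <= q * #|ext_neighbourhood U|.

(** [R] has at least |R|/q neighbours, at most |R|/(2q) of them outside [M]; the others lie in [M].
    Sizes up to a half are allowed so that the bound also serves for unions not yet known to be
    junk. *)
Lemma junk_card_le (M R : {set G}) :
  2 * #|R| <= #|G| -> 2 * q * #|ext_neighbourhood R :\: M| <= #|R| ->
  #|R| <= 2 * q * #|M|.
Proof.
move=> /G_expands H1 H2.
have : #|ext_neighbourhood R| <= #|ext_neighbourhood R :\: M| + #|M|.
  rewrite -(cardsID M (ext_neighbourhood R)) addnC leq_add2l.
  by rewrite subset_leq_card ?subsetIr.
nia.
Qed.

Lemma junk_card (M R : {set G}) : junk M R -> #|R| <= 2 * q * #|M|.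
Proof. by case/and3P=> _ R4; apply: junk_card_le; lia. Qed.

(* Maximality makes the rest expand: a non-expanding set could be added to the
   junk, and a set too large for that expands because [M] and the junk are
   small. *)
Lemma junk_extend (M R : {set G}) :
  8 * q * (2 * q + 1) * #|M| <= #|G| -> junk M R ->
  exists R' : {set G}, [/\ R \subset R', junk M R' &
    forall U : {set G}, U \subset ~: (M :|: R') -> U != set0 ->
      2 * #|U| <= #|G| ->
      #|U| <= 2 * q * #|ext_neighbourhood U :&: ~: (M :|: R')|].
Proof.
move=> M_small jR; have [R' mR' RR'] := maxset_exists jR.
have [jR' maxR'] := maxsetP mR'.
exists R'; split=> // U UV U0 U2; rewrite leqNgt; apply/negP => Ulow.
have [dis R'4 nR'] := and3P jR'; have R'M := junk_card jR'.
have R'U : [disjoint R' & U].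
  rewrite disjoint_sym disjoint_subset; apply: subset_trans UV _.
  by apply/subsetP => x; rewrite !inE negb_or => /andP[].
have cU : #|R' :|: U| = #|R'| + #|U|.
  by rewrite cardsU (disjoint_setI0 R'U) cards0 subn0.
have [U4|U4] := leqP (4 * #|U|) #|G|.
  have nU : 2 * q * #|ext_neighbourhood (R' :|: U) :\: M| <= #|R' :|: U|.
    have : #|ext_neighbourhood (R' :|: U) :\: M| <=
        #|ext_neighbourhood R' :\: M| +
        #|ext_neighbourhood U :&: ~: (M :|: R')|.
      apply: leq_trans (leq_card_setU _ _); apply: subset_leq_card.
      apply/subsetP => x; rewrite !inE !negb_or.
      case/and3P=> -> /andP[-> ->] /= /existsP[z /andP[+ zx]].
      rewrite inE; case/orP => zR; apply/orP; [left|right];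
        by rewrite ?andbT; apply/existsP; exists z; rewrite zR.
    rewrite cU; nia.
  (* So far the union is only known to have at most half of the vertices; [junk_card_le] brings it
     down to [2 * q * #|M|], at most a quarter. *)
  have jU : junk M (R' :|: U).
    have U2' : 2 * #|R' :|: U| <= #|G| by lia.
    apply/and3P; split=> //; last by have := junk_card_le U2' nU; nia.
    rewrite -setI_eq0 setIUl (disjoint_setI0 dis) set0U setI_eq0.
    rewrite disjoint_subset; apply: subset_trans UV _.
    by apply/subsetP => x; rewrite !inE negb_or => /andP[].
  have e := maxR' _ jU (subsetUl _ _).
  by move: U0; rewrite -card_gt0; move: cU; rewrite e; lia.
(* Now [U] exceeds a quarter. [M] and [R'] have at most [(2 * q + 1) * #|M|], hence at most |G|/(8q)
   < |U|/(2q) vertices, and cannot hold half of the neighbours of [U]. *)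
have := G_expands U2.
have : #|ext_neighbourhood U| <=
    #|ext_neighbourhood U :&: ~: (M :|: R')| + (#|M| + #|R'|).
  rewrite -(cardsID (M :|: R') (ext_neighbourhood U)) addnC setDE leq_add2l.
  rewrite (leq_trans _ (leq_card_setU _ _)) //.
  by rewrite subset_leq_card ?subsetIr.
nia.
Qed.
End Expanding.

Section Sparse.
Variables (G : sgraph) (q d g : nat).
Hypothesis g_le : 4 * g <= d.
Hypothesis G_sparse : forall U : {set G}, q * #|U| <= #|G| ->
  \sum_(u in U) #|[set v in U | adj u v]| <= d * #|U|.
Hypothesis G_degree : forall x : G, d <= degree x.

(** Each of [2 * #|W| + 1] such vertices would send at least [d - g + 1], more than 3d/4, edges into
    [W]. Counted from both ends, these exceed the degree sum allowed on the [3 * #|W| + 1] vertices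
    of the union. *)
Lemma few_absorbed (W : {set G}) : q * (3 * #|W| + 1) <= #|G| ->
  #|[set x | (x \notin W) && (#|[set y | adj x y] :\: W| < g)]| <= 2 * #|W|.
Proof.
set X := [set x | _] => W_small; rewrite leqNgt; apply/negP => X_large.
have [Y /subsetP YX cY] := exists_subset_card X_large.
have YW : [disjoint Y & W].
  by rewrite disjoint_subset; apply/subsetP => x /YX; rewrite !inE => /andP[].
have cYW : #|Y :|: W| = 3 * #|W| + 1.
  by rewrite cardsU (disjoint_setI0 YW) cards0 subn0 cY; lia.
have := G_sparse (U := Y :|: W); rewrite cYW => /(_ W_small).
rewrite leqNgt => /negP; apply.
rewrite (big_setID Y) /= setUK setDUl setDv set0U.
rewrite (setDidPl _); last by rewrite disjoint_sym.
have low1 : #|Y| * (d - g + 1) <=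
    \sum_(u in Y) #|[set v in W | adj u v]|.
  rewrite -sum_nat_const; apply: leq_sum => u /YX; rewrite inE => /andP[_ ug].
  have := G_degree u; rewrite /degree -(cardsID W [set y | adj u y]).
  rewrite (_ : _ :&: W = [set v in W | adj u v]); first lia.
  by apply/setP => y; rewrite !inE andbC.
have low2 : \sum_(u in Y) #|[set v in W | adj u v]| =
    \sum_(u in W) #|[set v in Y | adj u v]|.
  have expand (A B : {set G}) : \sum_(u in A) #|[set v in B | adj u v]| =
      \sum_(u in A) \sum_(v in B) adj u v.
    apply: eq_bigr => u _; rewrite -sum1_card big_mkcond [RHS]big_mkcond.
    by apply: eq_bigr => v _; rewrite inE; case: (v \in B); case: adj.
  rewrite !expand exchange_big /=.
  by apply: eq_bigr => u _; apply: eq_bigr => v _; rewrite adj_sym.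
have mono (A B : {set G}) : B \subset Y :|: W ->
    \sum_(u in A) #|[set v in B | adj u v]| <=
    \sum_(u in A) #|[set v in Y :|: W | adj u v]|.
  move=> /subsetP BU; apply: leq_sum => u _; apply/subset_leq_card/subsetP => v.
  by rewrite !inE => /andP[/BU]; rewrite inE => -> ->.
have := mono Y W (subsetUr _ _); have := mono W Y (subsetUl _ _).
rewrite -low2; move: low1; set s1 := \sum_(u in Y) _.
set s2 := \sum_(u in Y) _; set s3 := \sum_(u in W) _; rewrite cY.
have : 3 * d + 4 <= 4 * (d - g + 1) by lia.
move: (d - g + 1) => e; nia.
Qed.
End Sparse.

(** * Small degree *)

Definition branch_family (G : sgraph) (b : nat) (F : {set {set G}}) :=
  trivIset F /\
  forall A, A \in F -> [/\ A != set0, connected_set A & #|A| <= b].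

Lemma branch_family_add (G : sgraph) b (F : {set {set G}}) (Y : {set G}) :
  branch_family b F -> Y != set0 -> connected_set Y -> #|Y| <= b ->
  [disjoint Y & cover F] -> branch_family b (Y |: F) /\ Y \notin F.
Proof.
move=> [tF bF] Y0 cY Yb dY.
have F0 : set0 \notin F by apply/negP => /bF[]; rewrite eqxx.
have [|tYF YF] := trivIsetU1 _ tF F0 (A := Y).
  by move=> B BF; apply: disjointWr dY; exact: bigcup_sup.
by split=> //; split=> // A; rewrite !inE => /orP[/eqP-> //|/bF].
Qed.

Lemma card_cover_branch_family (G : sgraph) b (F : {set {set G}}) :
  branch_family b F -> #|cover F| <= #|F| * b.
Proof.
move=> [_ bF]; rewrite (leq_trans (card_bigcup_le _ _)) // -sum_nat_const.
by apply: leq_sum => A /bF[].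
Qed.

Lemma adjacent_sets_sym (G : sgraph) (A B : {set G}) :
  adjacent_sets A B -> adjacent_sets B A.
Proof. by move=> [u [v [uA vB uv]]]; exists v, u; rewrite adj_sym. Qed.

Lemma junk_set0 (G : sgraph) (q : nat) (M : {set G}) : junk q M set0.
Proof.
apply/and3P; rewrite cards0; split=> //; first by rewrite -setI_eq0 set0I.
rewrite (_ : ext_neighbourhood set0 = set0) ?set0D ?cards0 ?muln0 //.
by apply/setP => x; rewrite !inE; apply/existsP => -[z]; rewrite inE.
Qed.

Section PlotkinRaoSmith.
Variables (G : sgraph) (q l T : nat).
Hypothesis q_gt0 : 0 < q.
Hypothesis G_expands : forall U : {set G},
  2 * #|U| <= #|G| -> #|U| <= q * #|ext_neighbourhood U|.
Hypothesis G_gt0 : 0 < #|G|.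
Hypothesis G_lt : #|G| < 2 ^ l.

(** A new branch set connects at most [T] vertices: one neighbour of each of fewer than [T] earlier
    branch sets, and a base vertex. *)
Let b := T * (4 * q * l + 2).
Hypothesis T_small : 8 * q * (2 * q + 1) * (T * b) <= #|G|.

Let model (F : {set {set G}}) :=
  [/\ branch_family b F, #|F| <= T &
      forall A B, A \in F -> B \in F -> A != B -> adjacent_sets A B].

Let model_small F : model F -> 8 * q * (2 * q + 1) * #|cover F| <= #|G|.
Proof.
move=> [bF FT _]; apply: leq_trans T_small; rewrite leq_mul2l.
rewrite (leq_trans (card_cover_branch_family bF)) ?orbT // leq_mul2r FT.
by rewrite orbT.
Qed.

(* A branch set without neighbours in the expanding rest is thrown into the
   junk; the junk never shrinks and its size stays bounded. *)
Let grow_model m (F : {set {set G}}) (R : {set G}) :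
  (#|G| - #|R|) * T.+1 + (T - #|F|) < m -> model F ->
  junk q (cover F) R -> exists2 F', model F' & #|F'| = T.
Proof.
(* The measure is lexicographic: a discarded branch set enlarges the junk, which outweighs the at
   most [T] branch sets still to be grown; a new branch set lowers the second term. *)
elim: m F R => // m IH F R Hm mF jR.
have [bF FT adF] := mF; have M_small := model_small mF.
have [FT'|] := ltnP #|F| T; last by exists F => //; lia.
have [R' [RR' jR' expV]] := junk_extend q_gt0 G_expands M_small jR.
set V := ~: _ in expV; have RR'c := subset_leq_card RR'.
have R'M := junk_card q_gt0 G_expands jR'.
have [dis R'4 nR'] := and3P jR'.
case: (pickP (fun B => (B \in F) && (ext_neighbourhood B :&: V == set0))).
  move=> B /andP[BF /eqP nB].
  have [B0 cB Bb] := bF.2 _ BF.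
  have cov : cover F = B :|: cover (F :\ B).
    by rewrite /cover (big_setD1 B).
  have BM : B \subset cover F by rewrite cov subsetUl.
  have disB : [disjoint B & cover (F :\ B)].
    rewrite disjoint_sym -setI_eq0 -subset0; apply/subsetP => x.
    rewrite !inE => /andP[/bigcupP[C /setD1P[CB CF] xC] xB].
    have /trivIsetP/(_ _ _ CF BF CB) := bF.1.
    by move/pred0P/(_ x); rewrite /= xB xC.
  have disR'B : [disjoint R' & B].
    by rewrite disjoint_sym; apply: (disjointWl BM); rewrite disjoint_sym.
  have c1 : #|R' :|: B| = #|R'| + #|B|.
    by rewrite cardsU (disjoint_setI0 disR'B) cards0 subn0.
  have B_gt0 : 0 < #|B| by rewrite card_gt0.
  have BMc := subset_leq_card BM.
  have nRB : 2 * q * #|ext_neighbourhood (R' :|: B) :\: cover (F :\ B)| <=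
      #|R' :|: B|.
    rewrite c1; apply: leq_trans (leq_trans nR' (leq_addr _ _)).
    rewrite leq_mul2l; apply/orP; right; apply/subset_leq_card/subsetP => x.
    rewrite !inE !negb_or => /and3P[xM /andP[xR' xB] /existsP[z]].
    rewrite inE => /andP[zRB zx].
    have xM' : x \notin cover F by rewrite cov inE negb_or xB.
    rewrite xM' xR' /=; apply/existsP; exists z; rewrite zx andbT.
    case/orP: zRB => // zB; move/setP/(_ x): nB; rewrite !inE.
    rewrite xB negb_or xM' xR' !andbT /= => /negbT/negP[].
    by apply/existsP; exists z; rewrite zB.
  have covc : #|cover (F :\ B)| <= #|cover F|.
    by rewrite cov subset_leq_card ?subsetUr.
  have mF' : model (F :\ B).
    split.
    - split; first by apply: trivIsetS bF.1; exact: subsetDl.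
      by move=> A /setD1P[_ /bF.2].
    - by rewrite (leq_trans _ FT) // subset_leq_card ?subsetDl.
    - by move=> A C /setD1P[_ AF] /setD1P[_ CF]; exact: adF.
  apply: (IH (F :\ B) (R' :|: B)) => //.
    apply: leq_trans (_ : (#|G| - #|R|) * T.+1 <= _); last lia.
    have := max_card (R' :|: B); rewrite c1 => RB.
    have e : #|G| - #|R| = (#|G| - #|R|).-1.+1.
      by rewrite prednK // subn_gt0; lia.
    rewrite e mulSn.
    apply: leq_ltn_trans (_ : (#|G| - #|R|).-1 * T.+1 + T < _); last by lia.
    apply: leq_add; last exact: leq_subr.
    by rewrite leq_mul2r; apply/orP; right; lia.
  have R2 : 2 * #|R' :|: B| <= #|G| by rewrite c1; nia.
  apply/and3P; split=> //.
    rewrite -setI_eq0 setIUl (disjoint_setI0 disB) setU0 setI_eq0.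
    by apply: disjointWr dis; rewrite cov subsetUr.
  by have := junk_card_le q_gt0 G_expands R2 nRB; nia.
move=> noB.
have [v0 v0V] : exists v0, v0 \in V.
  apply/set0Pn; rewrite -card_gt0.
  have := (leq_card_setU (cover F) R').1; have := cardsC (cover F :|: R').
  rewrite -/V; set x := #|V|; set y := #|_ :|: _| => e1 e2.
  have : (2 * q + 1) * #|cover F| * 8 <= #|G|.
    by apply: leq_trans M_small; nia.
  lia.
have pickn B : exists v, B \in F -> v \in ext_neighbourhood B :&: V.
  have [BF|] := boolP (B \in F); last by exists v0.
  have := noB B; rewrite BF /= => /negbT/set0Pn[v vB].
  by exists v.
have [f fP] := fin_all_exists pickn.
have XV : v0 |: f @: F \subset V.
  rewrite subUset sub1set v0V; apply/subsetP => _ /imsetP[B BF ->].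
  by have /setIP[] := fP _ BF.
have X0 : v0 |: f @: F != set0 by apply/set0Pn; exists v0; rewrite !inE eqxx.
have [Y [XY YV cY Yc]] := connect_in_expander q_gt0 expV G_lt XV X0.
have Yb : #|Y| <= b.
  rewrite (leq_trans Yc) // leq_mul2r (leq_trans (leq_card_setU _ _)) ?orbT //.
  by rewrite cards1 (leq_trans _ FT') // add1n ltnS leq_imset_card.
have YM : [disjoint Y & cover F].
  rewrite disjoint_subset (subset_trans YV) //; apply/subsetP => x.
  by rewrite !inE negb_or => /andP[].
have Y0 : Y != set0.
  by apply/set0Pn; exists v0; apply: (subsetP XY); rewrite !inE eqxx.
have [bYF YF] := branch_family_add bF Y0 cY Yb YM.
have adY B : B \in F -> adjacent_sets B Y.
  move=> BF; have /setIP[] := fP _ BF; rewrite inE.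
  case/andP=> _ /existsP[u /andP[uB uf]] _; exists u, (f B); split=> //.
  by apply: (subsetP XY); rewrite inE imset_f ?orbT.
apply: (IH (Y |: F) R').
- have : (#|G| - #|R'|) * T.+1 <= (#|G| - #|R|) * T.+1.
    by rewrite leq_mul2r leq_sub2l ?orbT.
  by rewrite cardsU1 YF; lia.
- split=> //; first by rewrite cardsU1 YF.
  move=> A B /setU1P[->|AF] /setU1P[->|BF] AB; first by rewrite eqxx in AB.
  + by apply: adjacent_sets_sym; exact: adY.
  + exact: adY.
  + exact: adF.
have cov : cover (Y |: F) = Y :|: cover F.
  by rewrite /cover bigcup_setU big_set1.
apply/and3P; split=> //; rewrite cov.
  rewrite -setI_eq0 setIUr (disjoint_setI0 dis) setU0 setI_eq0 disjoint_sym.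
  rewrite disjoint_subset (subset_trans YV) //; apply/subsetP => x.
  by rewrite !inE negb_or => /andP[].
apply: leq_trans nR'; rewrite leq_mul2l; apply/orP; right.
by apply/subset_leq_card/setDS/subsetUr.
Qed.

Lemma expander_clique_minor : has_clique_minor G T.
Proof.
have m0 : model set0.
  split; last by move=> A B; rewrite inE.
  - by split=> [|A]; [apply/trivIsetP => A B | ]; rewrite inE.
  - by rewrite cards0.
have [F [[tF bF] _ adF] <-] := grow_model (ltnSn _) m0 (junk_set0 _ _).
by apply: clique_minor_of_sets => // A /bF[].
Qed.
End PlotkinRaoSmith.

(** * Hitting sets and stars *)

Lemma sum_card_setI (I T : finType) (F : {set I}) (P : I -> {set T})
    (D : {set T}) :
  \sum_(A in F) #|P A :&: D| = \sum_(w in D) #|[set A in F | w \in P A]|.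
Proof.
transitivity (\sum_(A in F) \sum_(w in D) (w \in P A)).
  apply: eq_bigr => A _; rewrite -sum1_card big_mkcond [RHS]big_mkcond.
  by apply: eq_bigr => w _; rewrite inE andbC; case: (w \in D); case: (w \in _).
rewrite exchange_big; apply: eq_bigr => w _.
rewrite -sum1_card big_mkcond [RHS]big_mkcond.
by apply: eq_bigr => A _; rewrite inE; case: (A \in F); case: (w \in _).
Qed.

Section HittingSet.
Variables (I T : finType) (P : I -> {set T}) (p k : nat).
Hypotheses (T_gt0 : 0 < #|T|) (k_gt0 : 0 < k) (p_le : p <= #|T|).
Hypothesis kp : #|T| <= k * p.

Let missed (A : {set I}) (H : {set T}) := [set i in A | H :&: P i == set0].

(** Greedy choice: by averaging, some point lies in at least a fraction p/|T| of the sets still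
    missed, so every new point leaves at most a fraction 1 - p/|T| of them. *)
Lemma hit_fraction (A : {set I}) j : (forall i, i \in A -> p <= #|P i|) ->
  exists2 H : {set T}, #|H| <= j &
    #|missed A H| * #|T| ^ j <= #|A| * (#|T| - p) ^ j.
Proof.
move=> AP; elim: j => [|j [H Hj IH]].
  by exists set0; rewrite ?cards0 // !muln1 subset_leq_card ?subsetDl //;
    apply/subsetP => i; rewrite inE => /andP[].
pose A' := missed A H; pose hits x := #|[set i in A' | x \in P i]|.
have [x xhits] : exists x, #|A'| * p <= #|T| * hits x.
  apply/existsP; rewrite -[X in is_true X]negbK negb_exists.
  apply/negP => /forallP small.
  have : \sum_(x : T) (#|T| * hits x).+1 <= \sum_(x : T) #|A'| * p.
    by apply: leq_sum => x _; rewrite ltnNge.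
  have dc : \sum_(x : T) hits x = \sum_(i in A') #|P i|.
    have := sum_card_setI A' P [set: T].
    rewrite [RHS](eq_bigl xpredT) => [<-|w]; last by rewrite inE.
    by apply: eq_bigr => i _; rewrite setIT.
  have A'P : #|A'| * p <= \sum_(i in A') #|P i|.
    rewrite -sum_nat_const; apply: leq_sum => i.
    by rewrite inE => /andP[/AP].
  rewrite sum_nat_const (eq_bigr (fun x => #|T| * hits x + 1)) => [|y _].
    rewrite big_split /= -big_distrr /= dc sum_nat_const.
    have -> : #|(fun _ : T => true)| = #|T| by exact: eq_card.
    by have := leq_mul (leqnn #|T|) A'P; lia.
  by rewrite addn1.
exists (x |: H).
  by rewrite (leq_trans (leq_card_setU _ _)) // cards1 add1n ltnS.
have -> : missed A (x |: H) = A' :\: [set i in A' | x \in P i].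
  apply/setP => i; rewrite !inE setIUl setU_eq0 setI_eq0 disjoints1.
  by case: (i \in A); case: (x \in P i); case: (_ == set0).
rewrite cardsD (setIidPr _); last by apply/subsetP => i; rewrite inE => /andP[].
rewrite -/(hits x) !expnS; move: IH; rewrite -/A'.
set u := #|A'| in xhits *; set h := hits x in xhits *; set n := #|T|.
rewrite -/n in xhits *.
move: (n ^ j) ((n - p) ^ j) => e f IH.
have uh : (u - h) * n <= u * (n - p) by rewrite mulnBl mulnBr; lia.
have := leq_mul IH (leqnn (n - p)); have := leq_mul uh (leqnn e).
by move: (u - h) (n - p) => u' n'; lia.
Qed.

(** As [k * p] is at least [#|T|], the factor (1 - p/|T|)^k is at most 1/2; [l] such halvings
    exhaust a family of fewer than [2 ^ l] sets. *)
Lemma half_hit (A : {set I}) : (forall i, i \in A -> p <= #|P i|) ->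
  exists2 H : {set T}, #|H| <= k & 2 * #|missed A H| <= #|A|.
Proof.
move=> /(hit_fraction k)[H Hk le]; exists H => //.
have n_gt0 : 0 < #|T| ^ k by rewrite expn_gt0 T_gt0.
have := expn_addl_double (m := #|T| - p) (p := p) k_gt0; rewrite subnK //.
move=> /(_ (leq_trans (leq_subr _ _) kp)) le2.
rewrite -(leq_pmul2r n_gt0); apply: leq_trans (leq_mul (leqnn #|A|) le2).
by rewrite -mulnA [X in _ <= X]mulnCA leq_mul2l.
Qed.

Lemma hitting_set l (A : {set I}) : #|A| < 2 ^ l ->
  (forall i, i \in A -> p <= #|P i|) ->
  exists2 H : {set T}, #|H| <= k * l &
    forall i, i \in A -> H :&: P i != set0.
Proof.
elim: l A => [|l IH] A Al AP.
  exists set0; rewrite ?cards0 // => i iA.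
  by move: Al iA; rewrite expn0 ltnS leqn0 cards_eq0 => /eqP->; rewrite inE.
have [H Hk H2] := half_hit AP.
have [||H' H'l H'P] := IH (missed A H).
- by move: Al; rewrite expnS; lia.
- by move=> i; rewrite inE => /andP[/AP].
exists (H :|: H').
  by rewrite (leq_trans (leq_card_setU _ _)) // mulnS leq_add.
move=> i iA; rewrite setIUl setU_eq0 negb_and.
have [//|/negPn HP] := boolP (H :&: P i != set0).
by rewrite H'P // inE iA.
Qed.
End HittingSet.

Section StarCentres.
Variables (G : sgraph) (q d g : nat).
Hypothesis g_le : 4 * g <= d.
Hypothesis G_sparse : forall U : {set G}, q * #|U| <= #|G| ->
  \sum_(u in U) #|[set v in U | adj u v]| <= d * #|U|.
Hypothesis G_degree : forall x : G, d <= degree x.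

(** [Z] is closed to centres, [O] to leaves. By [few_absorbed], applied to [O] and the leaves found
    so far, some vertex outside [Z] has [g] fresh neighbours and becomes the next centre. Leaves
    never repeat, so their number is exact. *)
Lemma star_centres (Z O : {set G}) a :
  q * (3 * (a * g + #|O|) + 1) <= #|G| ->
  3 * (a * g + #|O|) + #|Z| < #|G| ->
  exists X N : {set G}, [/\ X \subset ~: Z, #|X| <= a, [disjoint N & O],
    #|N| = a * g & forall w, w \in N -> exists2 x, x \in X & adj x w].
Proof.
elim: a => [|a IH] Hq Hn.
  exists set0, set0; rewrite sub0set cards0; split=> //.
    by rewrite -setI_eq0 set0I.
  by move=> w; rewrite inE.
have [||X [N [XZ Xa NO cN NX]]] := IH; [by nia|by nia|].
pose W := N :|: O.
have cW : #|W| = a * g + #|O|.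
  by rewrite cardsU (disjoint_setI0 NO) cards0 subn0 cN.
have := few_absorbed g_le G_sparse G_degree (W := W).
set bad := [set x | _] => badW.
have {}badW : #|bad| <= 2 * #|W| by apply: badW; rewrite cW; nia.
have [x] : exists x, x \in ~: (W :|: bad :|: Z).
  apply/set0Pn; rewrite -card_gt0.
  have := cardsC (W :|: bad :|: Z); have := (leq_card_setU W bad).1.
  have := (leq_card_setU (W :|: bad) Z).1.
  set c1 := #|W :|: bad|; set c2 := #|_ :|: Z|; set c3 := #|~: _|.
  by rewrite cW in badW *; nia.
rewrite !inE !negb_or => /andP[/andP[/andP[xN xO] xbad] xZ].
have xg : g <= #|[set y | adj x y] :\: W|.
  by move: xbad; rewrite ?negb_or xN xO /= -leqNgt.
have [Y /subsetP YW cY] := exists_subset_card xg.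
have YN : [disjoint Y & N].
  rewrite disjoint_subset; apply/subsetP => y /YW; rewrite !inE negb_or.
  by case/andP=> /andP[].
exists (x |: X), (Y :|: N); split.
- by rewrite subUset XZ sub1set inE xZ.
- by rewrite (leq_trans (leq_card_setU _ _)) // cards1 add1n ltnS.
- rewrite -setI_eq0 setIUl (disjoint_setI0 NO) setU0 setI_eq0 disjoint_subset.
  apply/subsetP => y /YW; rewrite !inE negb_or.
  by case/andP=> /andP[].
- by rewrite cardsU (disjoint_setI0 YN) cards0 subn0 cN cY mulSn.
- move=> w /setUP[/YW|/NX[z zX zw]].
    by rewrite !inE => /andP[_ xw]; exists x; rewrite ?inE ?eqxx.
  by exists z; rewrite // inE zX orbT.
Qed.
End StarCentres.

(** * Large degree *)

Section Rounds.
Variables (G : sgraph) (q d g a k l c o T : nat).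
Hypothesis q_gt0 : 0 < q.
Hypothesis G_expands : forall U : {set G},
  2 * #|U| <= #|G| -> #|U| <= q * #|ext_neighbourhood U|.
Hypothesis G_sparse : forall U : {set G}, q * #|U| <= #|G| ->
  \sum_(u in U) #|[set v in U | adj u v]| <= d * #|U|.
Hypothesis G_degree : forall x : G, d <= degree x.
Hypothesis g_le : 4 * g <= d.
Hypothesis G_gt0 : 0 < #|G|.
Hypothesis G_lt : #|G| < 2 ^ l.
Hypotheses (a_gt0 : 0 < a) (k_gt0 : 0 < k) (c_gt0 : 0 < c).

(** A branch set has up to [a] star centres, contributing [g] new leaves each, and takes in up to
    [k * l] hitting points. A vertex is a leaf of at most [c] branch sets, and [o] bounds the number
    of vertices that have reached this load. *)
Let s := a * g.
Let b := (a + k * l) * (4 * q * l + 2).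

Hypothesis T_le : T <= #|G|.
Hypothesis T_small : 8 * q * (2 * q + 1) * (T * b) <= #|G|.
Hypothesis ks : 2 * #|G| <= k * s.
Hypothesis o_ge : T * s <= c * o.
Hypothesis so_small : q * (3 * (s + o) + 1) <= #|G|.
Hypothesis so_small2 : 6 * (s + o) < #|G|.
Hypothesis cb_small : 4 * c * (2 * q + 1) * b <= s.

Let s_gt0 : 0 < s.
Proof.
have b_gt0 : 0 < b by rewrite muln_gt0 !addn_gt0 a_gt0 orbT.
apply: leq_trans cb_small; move: b_gt0; move: b => b' b_gt0.
by rewrite !muln_gt0 c_gt0 addn1.
Qed.

(* [nu A] is the leaf set of the branch set [A]; a branch set stays alive as
   long as half of its leaves are neither in a branch set nor junk. *)
Let alive (F : {set {set G}}) (nu : {set G} -> {set G}) (R A : {set G}) :=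
  s <= 2 * #|nu A :&: ~: (cover F :|: R)|.

(** Only alive pairs must be adjacent: dead branch sets stay in [F] and are counted at the end. *)
Let state (F : {set {set G}}) (nu : {set G} -> {set G}) (R : {set G}) :=
  [/\ branch_family b F,
      forall A, A \in F -> #|nu A| = s /\
        forall w, w \in nu A -> exists2 u, u \in A & adj u w,
      forall w, #|[set A in F | w \in nu A]| <= c,
      junk q (cover F) R &
      forall A B, A \in F -> B \in F -> A != B ->
        alive F nu R A -> alive F nu R B -> adjacent_sets A B].

Let cover_small (F : {set {set G}}) nu (R : {set G}) :
  #|F| <= T -> state F nu R ->
  8 * q * (2 * q + 1) * #|cover F| <= #|G| /\ #|cover F| <= T * b.
Proof.
move=> FT [bF _ _ _ _]; have h : #|cover F| <= T * b.
  by rewrite (leq_trans (card_cover_branch_family bF)) // leq_mul2r FT orbT.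
by split=> //; apply: leq_trans T_small; rewrite leq_mul2l h orbT.
Qed.

Let round (F : {set {set G}}) nu (R : {set G}) : #|F| < T -> state F nu R ->
  exists F' nu' R', state F' nu' R' /\ #|F'| = #|F|.+1.
Proof.
move=> FT st; have [M_small _] := cover_small (ltnW FT) st.
have [bF nuF load jR adF] := st.
have [R' [RR' jR' expV]] := junk_extend q_gt0 G_expands M_small jR.
set V := ~: _ in expV.
have R'M := junk_card q_gt0 G_expands jR'.
have [dis R'4 nR'] := and3P jR'.
(* Fully loaded vertices may not become leaves again. There are at most [o] of them, since the leaf
   sets have total size at most [T * s <= c * o]. *)
pose O := [set w | c <= #|[set A in F | w \in nu A]|].
have cO : #|O| <= o.
  have : #|O| * c <= T * s.
    rewrite -sum_nat_const.
    apply: leq_trans (_ : \sum_(w in O) #|[set A in F | w \in nu A]| <= _).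
      by apply: leq_sum => w; rewrite inE.
    rewrite -sum_card_setI; apply: leq_trans (_ : \sum_(A in F) s <= _).
      apply: leq_sum => A /nuF[<- _]; exact/subset_leq_card/subsetIl.
    by rewrite sum_nat_const leq_mul2r (ltnW FT) orbT.
  move/leq_trans => /(_ _ o_ge); rewrite mulnC leq_pmul2l //.
pose Z := cover F :|: R'.
have cZ : 2 * #|Z| < #|G|.
  have := (leq_card_setU (cover F) R').1; rewrite -/Z => cZ.
  have : (2 * q + 1) * #|cover F| * 8 <= #|G|.
    by apply: leq_trans M_small; nia.
  lia.
have [||X [N [XV Xa NO cN NX]]] :=
    star_centres (Z := Z) (O := O) (a := a) g_le G_sparse G_degree.
- apply: leq_trans so_small; rewrite leq_mul2l; apply/orP; right.
  by rewrite -/s; lia.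
- by rewrite -/s; lia.
pose Al := [set A in F | alive F nu R' A].
(* An alive branch set has at least half of its [s] leaves, rounded up, in [V]. *)
have p_le : s.+1./2 <= #|G| by rewrite -/s; lia.
have kp : #|G| <= k * s.+1./2.
  by have : k * s <= k * (2 * s.+1./2); [rewrite leq_mul2l; lia | lia].
have Al_lt : #|Al| < 2 ^ l.
  apply: leq_ltn_trans G_lt; apply: leq_trans T_le; apply: leq_trans (ltnW FT).
  by apply/subset_leq_card/subsetP => A; rewrite inE => /andP[].
have [|H0 H0c H0P] :=
    hitting_set (P := fun A => nu A :&: V) G_gt0 k_gt0 p_le kp Al_lt.
  by move=> A; rewrite inE => /andP[_]; rewrite /alive -/V; lia.
have X0 : X != set0.
  have : N != set0 by rewrite -card_gt0 cN.
  by case/set0Pn => w /NX[x xX _]; apply/set0Pn; exists x.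
pose S := X :|: (H0 :&: V).
have SV : S \subset V by rewrite subUset XV subsetIr.
have S0 : S != set0 by rewrite setU_eq0 negb_and X0.
have [Y [SY YV cY Yc]] := connect_in_expander q_gt0 expV G_lt SV S0.
have Yb : #|Y| <= b.
  rewrite (leq_trans Yc) // leq_mul2r (leq_trans (leq_card_setU _ _)) ?orbT //.
  by rewrite leq_add // (leq_trans _ H0c) // subset_leq_card ?subsetIl.
have YM : [disjoint Y & cover F].
  rewrite disjoint_subset (subset_trans YV) //; apply/subsetP => x.
  by rewrite !inE negb_or => /andP[].
have Y0 : Y != set0.
  have [x xS] := set0Pn _ S0.
  by apply/set0Pn; exists x; apply: (subsetP SY).
have [bYF YF] := branch_family_add bF Y0 cY Yb YM.
have neY A : A \in F -> (A == Y) = false.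
  by move=> AF; apply: contraNF YF => /eqP <-.
have cov : cover (Y |: F) = Y :|: cover F.
  by rewrite /cover bigcup_setU big_set1.
pose nu' A := if A == Y then N else nu A.
have nu'F A : A \in F -> nu' A = nu A by move=> AF; rewrite /nu' neY.
(* Cover and junk only grow, so a branch set alive after the round was alive before it. *)
have alive_old A : A \in F -> alive (Y |: F) nu' R' A -> alive F nu R' A.
  move=> AF; rewrite /alive nu'F // => /leq_trans; apply.
  rewrite leq_mul2l /=; apply/subset_leq_card/setIS; rewrite setCS cov.
  exact/setSU/subsetUr.
have alive_RR' A : alive F nu R' A -> alive F nu R A.
  move=> /leq_trans; apply; rewrite leq_mul2l /=.
  by apply/subset_leq_card/setIS; rewrite setCS; exact: setUS.
have adY A : A \in F -> alive F nu R' A -> adjacent_sets A Y.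
  move=> AF aA; have AAl : A \in Al by rewrite inE AF.
  have /set0Pn[w /setIP[wH /setIP[wnu wV]]] := H0P _ AAl.
  have [_ /(_ _ wnu)[u uA uw]] := nuF _ AF; exists u, w; split=> //.
  by apply: (subsetP SY); rewrite 2!inE wH wV orbT.
exists (Y |: F), nu', R'; split; last by rewrite cardsU1 YF.
split=> //.
- move=> A /setU1P[->|AF]; last by rewrite nu'F //; exact: nuF.
  rewrite /nu' eqxx; split=> // w /NX[x xX xw]; exists x => //.
  by apply: (subsetP SY); rewrite inE xX.
- move=> w; have [wN|wN] := boolP (w \in N).
    apply: (@leq_trans #|Y |: [set A in F | w \in nu A]|).
      apply/subset_leq_card/subsetP => A; rewrite !inE /nu'.
      by case: (A == Y).
    rewrite (leq_trans (leq_card_setU _ _)) // cards1 add1n.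
    have /pred0P/(_ w) := NO; rewrite /= wN inE /= => /negbT.
    by rewrite -ltnNge.
  apply: leq_trans (load w); apply/subset_leq_card/subsetP => A.
  by rewrite !inE /nu'; case: (A == Y) => //=; rewrite (negPf wN).
- apply/and3P; split=> //; rewrite cov.
    rewrite -setI_eq0 setIUr (disjoint_setI0 dis) setU0 setI_eq0 disjoint_sym.
    rewrite disjoint_subset (subset_trans YV) //; apply/subsetP => x.
    by rewrite !inE negb_or => /andP[].
  apply: leq_trans nR'; rewrite leq_mul2l; apply/orP; right.
  by apply/subset_leq_card/setDS/subsetUr.
- move=> A B /setU1P[->|AF] /setU1P[->|BF] AB aA aB.
  + by rewrite eqxx in AB.
  + by apply: adjacent_sets_sym; apply: adY => //; exact: alive_old.
  + by apply: adY => //; exact: alive_old.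
  + by apply: adF => //; apply/alive_RR'/alive_old.
Qed.

Let rounds j : j <= T -> exists F nu R, state F nu R /\ #|F| = j.
Proof.
elim: j => [|j IH] jT; last first.
  have [F [nu [R [st Fj]]]] := IH (ltnW jT).
  by rewrite -Fj in jT *; exact: round jT st.
exists set0, id, set0; split; last by rewrite cards0.
split.
- by split=> [|A]; [apply/trivIsetP => A B | ]; rewrite inE.
- by move=> A; rewrite inE.
- move=> w; rewrite (_ : [set A in _ | _] = set0) ?cards0 //.
  by apply/setP => A; rewrite !inE.
- exact: junk_set0.
- by move=> A B; rewrite inE.
Qed.

(** A dead branch set has more than s/2 leaves in the cover or the junk. Together these have at most
    [(2 * q + 1) * (T * b)] vertices, each of load at most [c], so by [cb_small] at most half of the
    [T] branch sets are dead. *)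
Lemma star_clique_minor : exists2 t, T <= 2 * t & has_clique_minor G t.
Proof.
have [F [nu [R [st FT]]]] := rounds (leqnn T).
have [M_small MTb] := cover_small (eq_leq FT) st.
have [[tF bF] nuF load jR adF] := st.
pose Al := [set A in F | alive F nu R A].
have AlF : Al \subset F by apply/subsetP => A; rewrite inE => /andP[].
exists #|Al|; last first.
  apply: clique_minor_of_sets.
  - exact: trivIsetS AlF tF.
  - by move=> A /(subsetP AlF)/bF[].
  - by move=> A B; rewrite !inE => /andP[AF aA] /andP[BF aB] AB; exact: adF.
have cF : #|Al| + #|F :\: Al| = T.
  by rewrite -FT -(cardsID Al F) (setIidPr AlF).
have RM := junk_card q_gt0 G_expands jR.
pose D := cover F :|: R.
have cD : #|D| <= (2 * q + 1) * (T * b).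
  have := (leq_card_setU (cover F) R).1; rewrite -/D; nia.
have dead : #|F :\: Al| * s <= 2 * \sum_(A in F) #|nu A :&: D|.
  rewrite -sum_nat_const big_distrr /= [leqRHS](big_setID Al) /=.
  apply: leq_trans (leq_addl _ _); apply: leq_sum => A.
  rewrite !inE => /andP[+ AF]; rewrite AF /= /alive -/D -ltnNge.
  have [<- _] := nuF _ AF; rewrite -(cardsID D (nu A)) setDE.
  lia.
have : \sum_(A in F) #|nu A :&: D| <= c * #|D|.
  rewrite sum_card_setI mulnC -sum_nat_const; apply: leq_sum => w _.
  exact: load.
move=> le.
have : #|F :\: Al| * s * 2 <= T * s.
  apply: leq_trans (_ : T * (4 * c * (2 * q + 1) * b) <= _); last first.
    by rewrite leq_mul2l cb_small orbT.
  have := leq_mul (leqnn c) cD; lia.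
rewrite mulnAC leq_pmul2r //; lia.
Qed.
End Rounds.

(** * Choice of the parameters *)

Lemma exists_sqrt_bracket (m n : nat) : 0 < m ->
  exists T, m * T ^ 2 <= n < m * T.+1 ^ 2.
Proof.
move=> m_gt0; pose P T := m * T ^ 2 <= n.
have P0 : exists T, P T by exists 0; rewrite /P muln0.
have Pn T : P T -> T <= n.
  by apply: leq_trans; rewrite -mulnn mulnA -[leqLHS]mul1n; case: T => // T;
    rewrite leq_mul // muln_gt0 m_gt0.
case: (ex_maxnP P0 Pn) => T PT maxT; exists T; rewrite [m * T ^ 2 <= n]PT /=.
by rewrite ltnNge; apply/negP => /maxT; rewrite ltnn.
Qed.

Lemma clique_minor1 (G : sgraph) : 0 < #|G| -> has_clique_minor G 1.
Proof.
case/card_gt0P=> x _; rewrite -(cards1 [set x]).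
apply: clique_minor_of_sets.
- by apply/trivIsetP => A B /set1P-> /set1P->; rewrite eqxx.
- move=> A /set1P->; split; last exact: connected_set1.
  by apply/set0Pn; exists x; rewrite inE.
- by move=> A B /set1P-> /set1P->; rewrite eqxx.
Qed.

Section CliqueMinorSize.
Variables (G : sgraph) (q d l : nat).
Hypothesis q_gt0 : 0 < q.
Hypothesis G_expands : forall U : {set G},
  2 * #|U| <= #|G| -> #|U| <= q * #|ext_neighbourhood U|.
Hypothesis G_sparse : forall U : {set G}, q * #|U| <= #|G| ->
  \sum_(u in U) #|[set v in U | adj u v]| <= d * #|U|.
Hypothesis G_degree : forall x : G, d <= degree x.
Hypothesis G_gt0 : 0 < #|G|.
Hypothesis G_lt : #|G| < 2 ^ l.

Let l_gt0 : 0 < l.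
Proof. by case: l G_lt => // H; move: G_gt0; rewrite leqNgt H. Qed.

Lemma expander_minor_size :
  exists2 t, #|G| <= 576 * q ^ 3 * l * t ^ 2 & has_clique_minor G t.
Proof.
(* 144 is the product of 8, 3 and 6, from [2 * q + 1 <= 3 * q] and [4 * q * l + 2 <= 6 * q * l] in
   the condition on [T]; replacing [T.+1] by [2 * T] costs a further 4. *)
have [|T /andP[T1 T2]] := @exists_sqrt_bracket (144 * q ^ 3 * l) #|G|.
  by rewrite !(expn_gt0, muln_gt0) q_gt0 ?l_gt0.
have [T0|T_gt0] := posnP T.
  exists 1; last exact: clique_minor1.
  by apply: leq_trans (ltnW T2) _; rewrite T0; lia.
exists T.
  apply: leq_trans (ltnW T2) _.
  have : T.+1 ^ 2 <= (2 * T) ^ 2 by rewrite leq_exp2r //; lia.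
  move/(leq_mul (leqnn (144 * q ^ 3 * l))) => H; apply: leq_trans H _.
  by rewrite expnMn; lia.
apply: (expander_clique_minor (l := l) q_gt0) => //.
apply: leq_trans T1.
have q1 : 2 * q + 1 <= 3 * q by lia.
have ql : 4 * q * l + 2 <= 6 * q * l.
  have : 0 < q * l by rewrite muln_gt0 q_gt0.
  lia.
have := leq_mul (leq_mul (leqnn (8 * q)) q1) (leq_mul (leqnn (T * T)) ql).
rewrite -!mulnn !expnS expn0 => H.
by apply: leq_trans (leq_trans _ H) _; lia.
Qed.

(** The ratio of [g] to the load [c]. With [b] at most [12 * q * l * a], [g = kappa * c] is just
    enough for [cb_small]. *)
Let kappa := 144 * q ^ 2 * l.

Lemma star_minor_size : 512 * q ^ 2 * l * kappa <= d ->
  exists2 t, #|G| * d <= 1024 * 8 * q ^ 4 * (192 * kappa * l) ^ 2 * t ^ 2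
           & has_clique_minor G t.
Proof.
set E := 512 * q ^ 2 * l * kappa => Ed.
have kappa_gt0 : 0 < kappa by rewrite !(expn_gt0, muln_gt0) q_gt0 ?l_gt0.
have E_gt0 : 0 < E by rewrite !(expn_gt0, muln_gt0) q_gt0 l_gt0.
(* This makes [g = kappa * c] equal to d/(512 q^2 l) up to a factor 2; the divisor 512 q^2 l is what
   [s_small] needs. *)
pose c := d %/ E; have c_gt0 : 0 < c by rewrite divn_gt0.
have cE : c * E <= d := leq_trunc_div d E.
have dE : d <= 2 * c * E.
  have := ltn_ceil d E_gt0; rewrite -/c => /ltnW/leq_trans; apply.
  by rewrite leq_mul2r; lia.
pose g := kappa * c.
have dn : d <= #|G|.
  have [x _] := card_gt0P G_gt0.
  exact: leq_trans (G_degree x) (max_card _).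
have gE : 512 * q ^ 2 * l * g = c * E by rewrite /g /E; lia.
have g_gt0 : 0 < g by rewrite muln_gt0 kappa_gt0.
have lg_gt0 : 0 < l * g by rewrite muln_gt0 l_gt0.
have q2l_gt0 : 0 < q ^ 2 * l by rewrite !(expn_gt0, muln_gt0) q_gt0 ?l_gt0.
(* [k = k0.+1] lies just above the square root of 2|G|/(lg), so [k * s = l * g * k ^ 2] is between
   [2 * #|G|] and [8 * #|G|]. *)
have [k0 /andP[k1 k2]] := exists_sqrt_bracket (2 * #|G|) lg_gt0.
have lgn : l * g <= 2 * #|G|.
  suff : l * g <= 512 * q ^ 2 * l * g by lia.
  by rewrite -mulnA leq_pmull // !(expn_gt0, muln_gt0) q_gt0 ?l_gt0.
have k0_gt0 : 0 < k0.
  by rewrite lt0n; apply/eqP => k00; move: k2; rewrite k00 ltnNge muln1 lgn.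
pose k := k0.+1; pose a := k * l.
have kup : l * g * k ^ 2 <= 8 * #|G|.
  have : k ^ 2 <= (2 * k0) ^ 2 by rewrite leq_exp2r //; rewrite /k; lia.
  move/(leq_mul (leqnn (l * g))) => H; apply: leq_trans H _.
  by rewrite expnMn; lia.
have a_gt0 : 0 < a by rewrite muln_gt0.
have s_small : 8 * q * (a * g) <= #|G|.
  rewrite -(@leq_exp2r _ _ 2) //.
  apply: leq_trans (_ : 64 * q ^ 2 * (l * g) * (8 * #|G|) <= _).
    have := leq_mul (leqnn (64 * q ^ 2 * (l * g))) kup.
    by rewrite /a !expnMn; lia.
  have : 512 * q ^ 2 * l * g <= #|G| by lia.
  move/(leq_mul (leqnn #|G|)) => H; rewrite -mulnn; apply: leq_trans H; lia.
(* With [o = T * a * kappa], for which [T * s = c * o], the factor 48 gives [48 * q * o <= #|G|];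
   then [6 * (s + o)] is at most 3/4 + 1/8 of [#|G|]. *)
pose M := 48 * q * kappa * a.
have M_gt0 : 0 < M.
  by rewrite /M muln_gt0 a_gt0 andbT muln_gt0 kappa_gt0 andbT muln_gt0 q_gt0.
pose T := #|G| %/ M.
have TM : T * M <= #|G| := leq_trunc_div #|G| M.
have nT : #|G| < T.+1 * M := ltn_ceil #|G| M_gt0.
have q1 : 2 * q + 1 <= 3 * q by lia.
have ql : 4 * q * l + 2 <= 6 * q * l.
  have : 0 < q * l by rewrite muln_gt0 q_gt0.
  lia.
have b_le : (a + k * l) * (4 * q * l + 2) <= 12 * q * l * a.
  by have := leq_mul (leqnn (2 * a)) ql; rewrite -/a; lia.
have q512 : 512 * q <= #|G|.
  apply: leq_trans dn; apply: leq_trans cE; rewrite -gE.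
  have : 0 < q * l * g by rewrite !muln_gt0 q_gt0 l_gt0.
  move=> h; have := leq_mul (leqnn (512 * q)) h; lia.
have s_le : a * g <= q * (a * g) by rewrite leq_pmull.
have o_le : T * a * kappa <= q * (T * a * kappa) by rewrite leq_pmull.
have o_small : 48 * (q * (T * a * kappa)) <= #|G|.
  by apply: leq_trans TM; rewrite /M; lia.
have [||||||||t Tt tG] := @star_clique_minor G q d g a k l c (T * a * kappa) T
    q_gt0 G_expands G_sparse G_degree _ G_gt0 G_lt a_gt0 (ltn0Sn _) c_gt0.
- apply: leq_trans cE; rewrite -gE leq_mul2r; apply/orP; right.
  by have := leq_mul (leqnn 512) q2l_gt0; lia.
- exact: leq_div.
- have := leq_mul (leq_mul (leqnn (8 * q)) q1) (leq_mul (leqnn T) b_le).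
  move=> H; apply: leq_trans H _; apply: leq_trans TM.
  by rewrite /M /kappa; lia.
- by apply: leq_trans (ltnW k2) _; rewrite /a -/k; lia.
- by rewrite /g; lia.
- by move: s_small o_small; move: (a * g) (T * a * kappa) => s o; lia.
- by move: s_le o_le s_small o_small; move: (a * g) (T * a * kappa) => s o; lia.
- have := leq_mul (leq_mul (leqnn (4 * c)) q1) b_le.
  by move=> H; apply: leq_trans H _; rewrite /g /kappa; lia.
(* [t] may be 0 when [T] is 0; with [maxn t 1] the bound on [T.+1] holds in every case. *)
exists (maxn t 1); last first.
  by case: t tG {Tt} => [|t] tG; [exact: clique_minor1 | rewrite (maxn_idPl _)].
have t_gt0 : 0 < maxn t 1 by rewrite leq_max orbT.
have {tG} : T.+1 <= 4 * maxn t 1 by lia.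
move: (maxn t 1) t_gt0 => u u_gt0 Tu {t Tt}.
have nu : #|G| <= 192 * q * kappa * l * u * k.
  apply: leq_trans (ltnW nT) _; apply: leq_trans (leq_mul Tu (leqnn M)) _.
  by rewrite /M /a; lia.
(* Squaring [nu] and inserting [kup] removes [k] and one factor [#|G|]; [gE] and [dE] then turn [g]
   back into [d]. *)
have nlg : #|G| * (l * g) <= 8 * (192 * q * kappa * l * u) ^ 2.
  rewrite -(leq_pmul2l G_gt0).
  apply: leq_trans (_ : (192 * q * kappa * l * u * k) ^ 2 * (l * g) <= _).
    by rewrite mulnA leq_mul2r -mulnn leq_mul ?orbT.
  have := leq_mul (leqnn ((192 * q * kappa * l * u) ^ 2)) kup.
  by rewrite (expnMn _ k); move: (_ ^ 2) (k ^ 2) => x y; lia.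
apply: leq_trans (leq_mul (leqnn _) dE) _.
apply: leq_trans (_ : 1024 * q ^ 2 * (#|G| * (l * g)) <= _).
  by rewrite -(mulnA 2 c) -gE; lia.
apply: leq_trans (leq_mul (leqnn (1024 * q ^ 2)) nlg) _.
have -> : 192 * q * kappa * l * u = q * (192 * kappa * l) * u by lia.
have -> : q ^ 4 = q ^ 2 * q ^ 2 by rewrite -expnD.
rewrite (expnMn _ u) (expnMn q); move: (_ * l) => X.
by move: (X ^ 2) (q ^ 2) (u ^ 2) => x y z; lia.
Qed.
End CliqueMinorSize.

(** If [d] is at least a constant times [l ^ 2], the stars apply, with loss [l ^ 4]. Otherwise
    [expander_minor_size] loses [l] and the bound on [d] another [l ^ 2]. [K] depends on [q]
    alone. *)
Lemma large_clique_minor (q : nat) : 0 < q -> exists2 K, 0 < K &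
  forall (G : sgraph) (d l : nat), 0 < #|G| -> #|G| < 2 ^ l ->
    (forall U : {set G},
      2 * #|U| <= #|G| -> #|U| <= q * #|ext_neighbourhood U|) ->
    (forall U : {set G}, q * #|U| <= #|G| ->
      \sum_(u in U) #|[set v in U | adj u v]| <= d * #|U|) ->
    (forall x : G, d <= degree x) ->
  exists2 t, #|G| * d <= K * l ^ 4 * t ^ 2 & has_clique_minor G t.
Proof.
move=> q_gt0; pose K1 := 1024 * 8 * q ^ 4 * (192 * (144 * q ^ 2)) ^ 2.
pose K2 := 576 * q ^ 3 * (512 * q ^ 2 * (144 * q ^ 2)).
exists (K1 + K2) => [|G d l G_gt0 Gl G_expands G_sparse G_degree].
  by rewrite addn_gt0 !(expn_gt0, muln_gt0) q_gt0.
have l_gt0 : 0 < l by case: l Gl => // Gl; move: G_gt0; rewrite leqNgt Gl.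
case: (leqP (512 * q ^ 2 * l * (144 * q ^ 2 * l)) d) => d_le.
  have [t nd tG] :=
    star_minor_size q_gt0 G_expands G_sparse G_degree G_gt0 Gl d_le.
  exists t => //; apply: leq_trans nd _.
  rewrite leq_mul2r; apply/orP; right.
  apply: leq_trans (_ : K1 * l ^ 4 <= _); last first.
    by rewrite leq_mul2r leq_addr orbT.
  have -> : 192 * (144 * q ^ 2 * l) * l = 192 * (144 * q ^ 2) * l ^ 2 by lia.
  rewrite (expnMn _ (l ^ 2)) -expnM /K1; move: (l ^ (2 * 2)) => y.
  by rewrite !mulnA.
have [t nt tG] := expander_minor_size q_gt0 G_expands G_gt0 Gl.
exists t => //; apply: leq_trans (leq_mul nt (ltnW d_le)) _.
apply: leq_trans (_ : K2 * l ^ 3 * t ^ 2 <= _).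
  by rewrite /K2; lia.
rewrite leq_mul2r leq_mul ?orbT ?leq_addl //.
by rewrite leq_pexp2l.
Qed.

(** * Real parameters *)

Lemma sum_degree_le (G : sgraph) :
  \sum_(x : G) degree x <= 2 * #|edges G|.
Proof.
apply: leq_trans
  (_ : \sum_(x in [set: G]) #|[set e in edges G | x \in e]| <= _).
  rewrite [leqRHS](eq_bigl xpredT) => [|x]; last by rewrite inE.
  apply: leq_sum => x _.
  rewrite /degree -(card_in_imset (f := fun y => [set x; y])) => [|y z].
    apply/subset_leq_card/subsetP => _ /imsetP[y + ->]; rewrite !inE eqxx => xy.
    rewrite andbT; apply/existsP; exists x; apply/existsP; exists y.
    by rewrite xy /=.
  rewrite !inE => xy xz /setP/(_ y); rewrite !inE eqxx orbT.
  by case: eqP => [yx|_]; [rewrite yx adj_irrefl in xy | move/esym/eqP].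
rewrite -(sum_card_setI (edges G) id) mulnC -sum_nat_const.
apply: leq_sum => e; rewrite setIT inE.
case/existsP=> x /existsP[y /andP[_ /eqP->]].
by rewrite cards2; case: (_ != _).
Qed.

Lemma sum_induced_degree (G : sgraph) (U : {set G}) :
  \sum_(u in U) #|[set v in U | adj u v]| <= 2 * #|edges (induced U)|.
Proof.
apply: leq_trans (sum_degree_le _); apply: eq_leq.
rewrite (reindex_omap (val : induced U -> G) insub) => [|u uU]; last first.
  by rewrite insubT.
apply: eq_big => [u|u _]; first by rewrite valK eqxx (valP u).
rewrite /degree -(card_imset _ val_inj); apply: eq_card => v.
rewrite !inE; apply/andP/imsetP => [[vU uv]|[w + ->]].
  by exists (exist _ v vU); rewrite ?inE.
by rewrite inE => uw; split=> //; exact: (valP w).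
Qed.

Local Open Scope ring_scope.

(** Outside a set of floor(|G|/2) vertices there are at most twice as many. The bound serves to make
    the sparsity factor eps/2 at most 1. *)
Lemma expanding_eps_le2 (R : realType) (eps : R) (G : sgraph) :
  (1 < #|G|)%N -> vertex_expanding eps G -> eps <= 2.
Proof.
move=> G_gt1 G_expands.
have [|U _ cU] := @exists_subset_card G [set: G] #|G|./2.
  by rewrite cardsT; lia.
have U_gt0 : (0 < #|U|)%N by rewrite cU; lia.
have := G_expands U; rewrite ler_pdivlMr // -natrM ler_nat => /(_ ltac:(lia)) h.
rewrite -(ler_pM2r (x := #|U|%:R)) ?ltr0n //; apply: le_trans h _.
rewrite -natrM ler_nat.
have : (#|ext_neighbourhood U| <= #|~: U|)%N.
  by apply/subset_leq_card/subsetP => x; rewrite !inE => /andP[].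
have := cardsC U; lia.
Qed.

Lemma sparse_nat (R : realType) (eps : R) (G : sgraph) (q d : nat) :
  0 < eps -> 2 / eps <= q%:R -> eps <= 2 ->
  locally_sparse (eps / 2) d%:R G ->
  forall U : {set G}, (q * #|U| <= #|G|)%N ->
    (\sum_(u in U) #|[set v in U | adj u v]| <= d * #|U|)%N.
Proof.
move=> eps_gt0 q_ge eps_le G_sparse U qU.
have [->|U_gt0] := set_0Vmem U; first by rewrite big_set0.
have {}U_gt0 : (0 < #|U|)%N by case: U_gt0 => x xU; apply/card_gt0P; exists x.
apply: leq_trans (sum_induced_degree U) _.
have : average_degree R (induced U) <= eps / 2 * d%:R.
  apply: G_sparse; rewrite mulrAC ler_pdivlMr // mulrC.
  rewrite -ler_pdivrMl // mulrA; apply: le_trans (_ : q%:R * #|U|%:R <= _).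
    by rewrite [_^-1 * _]mulrC ler_wpM2r.
  by rewrite -natrM ler_nat.
rewrite /average_degree card_sig ler_pdivrMr ?ltr0n // => h.
rewrite -(ler_nat R) natrM; apply: le_trans h _; rewrite natrM.
rewrite ler_wpM2r // -[leRHS]mul1r ler_wpM2r //.
by rewrite ler_pdivrMr // mul1r.
Qed.

Lemma expanding_nat (R : realType) (eps : R) (G : sgraph) (q : nat) :
  0 < eps -> 2 / eps <= q%:R -> vertex_expanding eps G ->
  forall U : {set G}, (2 * #|U| <= #|G|)%N ->
    (#|U| <= q * #|ext_neighbourhood U|)%N.
Proof.
move=> eps_gt0 q_ge G_expands U U2.
have : eps * #|U|%:R <= #|ext_neighbourhood U|%:R.
  by apply: G_expands; rewrite ler_pdivlMr // -natrM ler_nat mulnC.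
rewrite -ler_pdivlMl // => h; rewrite -(ler_nat R) natrM.
apply: le_trans h _; rewrite ler_wpM2r //; apply: le_trans q_ge.
by rewrite ler_pMl ?invr_gt0 // ler1n.
Qed.

Theorem theorem3 (R : realType) :
  exists k : nat, forall eps : R, 0 < eps ->
  exists c : R, 0 < c /\
  exists n0 : nat, forall (n d : nat) (G : sgraph),
    (n0 <= n)%N -> (0 < d)%N -> #|G| = n ->
    locally_sparse (eps / 2) d%:R G ->
    vertex_expanding eps G ->
    has_min_degree G d ->
    exists t : nat,
      c * (Num.sqrt (n%:R * d%:R) / ln n%:R ^+ 10) / ln n%:R ^+ k <= t%:R /\
      has_clique_minor G t.
Proof.
(* The minor found has size at least a constant times sqrt(nd)/log^2 n, so the ten logarithms
   already granted suffice. *)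
exists 0%N => eps eps_gt0.
pose q := (Num.truncn (2 / eps)).+1.
have q_ge : 2 / eps <= q%:R by apply/ltW/truncnS_gt.
have [K K_gt0 minorK] := large_clique_minor (ltn0Sn (Num.truncn (2 / eps))).
have ln2_gt0 : 0 < ln 2 :> R by rewrite ln_gt0 // ltr1n.
(* Two powers of [ln 2] and the 4 come from [lL], the other eight powers from [ln 2 <= ln n], and
   [K] from the square root by K <= K^2. *)
exists (ln 2 ^+ 10 / (4 * K%:R)); split.
  by rewrite divr_gt0 ?exprn_gt0 // mulr_gt0 // ltr0n.
exists 2%N => n d G n_ge d_gt0 Gn G_sparse G_expands [G_degree _].
have G_gt1 : (1 < #|G|)%N by rewrite Gn.
have eps_le := expanding_eps_le2 G_gt1 G_expands.
have Gl : (#|G| < 2 ^ (trunc_log 2 n).+1)%N by rewrite Gn trunc_log_ltn.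
have [t nd tG] := minorK G d _ (ltnW G_gt1) Gl
  (expanding_nat eps_gt0 q_ge G_expands)
  (sparse_nat eps_gt0 q_ge eps_le G_sparse) G_degree.
exists t; split=> //.
set l := (trunc_log 2 n).+1 in nd; rewrite expr0 divr1.
set L := ln n%:R.
have L_ge : ln 2 <= L by rewrite ler_ln ?posrE ?ltr0n ?ler_nat //; lia.
have L_gt0 : 0 < L by apply: lt_le_trans L_ge.
have lL : l%:R * ln 2 <= 2 * L.
  have : (trunc_log 2 n)%:R * ln 2 <= L.
    rewrite mulr_natl -lnXn // ler_ln ?posrE ?exprn_gt0 ?ltr0n //; last lia.
    by rewrite -natrX ler_nat trunc_logP //; lia.
  move=> h; rewrite /l -[_.+1%:R]natr1 mulrDl mul1r [2 * L]mulr_natl mulr2n.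
  exact: lerD.
have sq : Num.sqrt (n%:R * d%:R) <= K%:R * l%:R ^+ 2 * t%:R :> R.
  rewrite -[leRHS]ger0_norm ?mulr_ge0 ?exprn_ge0 // -sqrtr_sqr.
  rewrite ler_wsqrtr // -[l%:R ^+ 2]natrX -!natrM -natrX ler_nat -Gn.
  rewrite (expnMn _ t) (expnMn K) -expnM; apply: leq_trans nd _.
  by rewrite leq_mul2r leq_mul2r -mulnn leq_pmulr ?orbT.
rewrite mulrA ler_pdivrMr ?exprn_gt0 // mulrAC ler_pdivrMr ?mulr_gt0 ?ltr0n //.
apply: le_trans (_ : ln 2 ^+ 10 * (K%:R * l%:R ^+ 2 * t%:R) <= _).
  by rewrite ler_wpM2l // exprn_ge0 // ltW.
rewrite [X in X <= _]
  (_ : _ = ln 2 ^+ 8 * (l%:R * ln 2) ^+ 2 * (K%:R * t%:R)); last first.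
  by ring.
rewrite [X in _ <= X]
  (_ : _ = L ^+ 8 * (2 * L) ^+ 2 * (K%:R * t%:R)); last first.
  by ring.
rewrite ler_wpM2r ?mulr_ge0 // ler_pM ?exprn_ge0 ?mulr_ge0 ?(ltW ln2_gt0) //.
  by apply: lerXn2r => //; rewrite nnegrE ltW.
by apply: lerXn2r => //; rewrite nnegrE mulr_ge0 // ltW.
Qed.
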